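(* Let $\alpha\in(0,2)$. For any $n,j,k\in\mathbb Z\setminus\{0\}$ satisfying $k=j+n$, it results $$|\omega_\alpha(k)-\omega_\alpha(j)-\omega_\alpha(n)|\ \ge\ \omega_\alpha(2)\ >\ 0 .$$
   Context: $\omega_\alpha(j)=j\,L_\alpha(|j|)$ for $j\in\mathbb Z$, where $$L_\alpha(|j|)=\frac{c_\alpha}{2(1-\frac\alpha2)}\Big[\mathsf T^1_\alpha(|j|)-\mathsf T^2_\alpha(|j|)-\frac{\Gamma(2-\alpha)}{\Gamma(1-\frac\alpha2)^2}\Big],\qquad c_\alpha=\frac{\Gamma(\frac\alpha2)}{2^{1-\alpha}\Gamma(1-\frac\alpha2)},$$ $$\mathsf T^1_\alpha(|j|)=\frac{\Gamma(2-\alpha)}{\Gamma(1-\frac\alpha2)\Gamma(\frac\alpha2)}\sum_{k=0}^{|j|-1}\frac{\Gamma(\frac\alpha2+k)}{\Gamma(1-\frac\alpha2+k)}\,\frac1{1-\frac\alpha2+k},\quad \mathsf T^1_\alpha(0)=0,\qquad \mathsf T^2_\alpha(|j|)=\frac{\Gamma(2-\alpha)}{\Gamma(1-\frac\alpha2)\Gamma(\frac\alpha2)}\,\frac{\Gamma(\frac\alpha2+|j|)}{\Gamma(1-\frac\alpha2+|j|)},$$ and $\Gamma$ is the Euler Gamma function. *)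

(* Defs.v *)
From HB Require Import structures.
From mathcomp Require Import all_boot all_order all_algebra.
From mathcomp Require Import all_classical all_reals all_analysis.
Set Implicit Arguments.
Unset Strict Implicit.
Unset Printing Implicit Defensive.
Import Order.TTheory GRing.Theory Num.Theory.
Import numFieldNormedType.Exports.
Local Open Scope classical_set_scope.
Local Open Scope ring_scope.

(* Euler's Gamma function as a Lebesgue integral. It is meaningful for x > 0
   only: for x <= 0 the integral diverges and Rintegral returns 0. When
   0 < alpha < 2, every argument of Gamma below is positive. *)
Definition Gamma (R : realType) (x : R) : R :=
  \int[@lebesgue_measure R]_(t in `]0, +oo[) (t `^ (x - 1) * expR (- t)).

Definition c_ (R : realType) (alpha : R) : R :=
  Gamma (alpha / 2) / (2 `^ (1 - alpha) * Gamma (1 - alpha / 2)).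

Definition T1 (R : realType) (alpha : R) (m : nat) : R :=
  Gamma (2 - alpha) / (Gamma (1 - alpha / 2) * Gamma (alpha / 2)) *
  \sum_(0 <= k < m)
    Gamma (alpha / 2 + k%:R) / Gamma (1 - alpha / 2 + k%:R) *
    (1 / (1 - alpha / 2 + k%:R)).

Definition T2 (R : realType) (alpha : R) (m : nat) : R :=
  Gamma (2 - alpha) / (Gamma (1 - alpha / 2) * Gamma (alpha / 2)) *
  (Gamma (alpha / 2 + m%:R) / Gamma (1 - alpha / 2 + m%:R)).

Definition L_ (R : realType) (alpha : R) (m : nat) : R :=
  c_ alpha / (2 * (1 - alpha / 2)) *
  (T1 alpha m - T2 alpha m - Gamma (2 - alpha) / Gamma (1 - alpha / 2) ^+ 2).

Definition omega (R : realType) (alpha : R) (j : int) : R :=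
  j%:~R * L_ alpha `|j|%N.

(* Main.v *)
(** Put a = alpha/2, g(m) = Gamma(a + m) / Gamma(1 - a + m). Up to a positive
    constant, L(m) = sum_{k < m} g(k) / (1 - a + k) - g(m) - g(0). The functional
    equation of Gamma gives g(m+1) = g(m) (a + m) / (1 - a + m), whence L(1) = 0
    and L(m+1) - L(m) = 2 (1 - a) s(m) with s(m) = g(m) / (1 - a + m) > 0. The
    second difference of m L(m) at m is then a positive multiple of
    (m + 2) s(m+1) - m s(m) = 2 a (m + 1) s(m+1) / (a + m) > 0, so omega is convex
    on the nonnegative integers; since omega(0) = omega(1) = 0, the quantity
    omega(p + q) - omega(p) - omega(q) increases in p and q, and its value at
    p = q = 1 is omega(2). Oddness of omega reduces the other signs of j and n to
    this case. *)
Require Import Defs.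
From mathcomp Require Import all_boot all_order all_algebra.
From mathcomp Require Import all_classical all_reals all_analysis.
From mathcomp Require Import measurable_realfun ring lra.
Import Order.TTheory GRing.Theory Num.Theory.
Import numFieldNormedType.Exports.
Local Open Scope classical_set_scope.
Local Open Scope ring_scope.
Set Implicit Arguments.
Unset Strict Implicit.

(** * Euler's integral: finiteness, functional equation, positivity *)

Definition gamma_int {R : realType} (x t : R) : R := t `^ (x - 1) * expR (- t).

(** Kept in the extended reals so that the functional equation can be proved before finiteness is
    known for all [x > 0]; [Gamma x] is [fine (Gamma_e x)] by conversion. *)
Definition Gamma_e {R : realType} (x : R) : \bar R :=
  (\int[@lebesgue_measure R]_(t in `]0%R, +oo[) (gamma_int x t)%:E)%E.

Lemma gamma_int_ge0 (R : realType) (x t : R) : 0 <= gamma_int x t.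
Proof. by rewrite mulr_ge0 ?powR_ge0 ?expR_ge0. Qed.

Lemma measurable_gamma_int (R : realType) (x : R) (D : set R) :
  measurable_fun D (gamma_int x).
Proof.
apply: measurable_funTS; apply: measurable_funM.
- exact: measurable_powR.
- exact: measurableT_comp.
Qed.

(* From 1 + u <= exp u at u = t / (2 x). *)
Lemma powR_expR_bound (R : realType) (x t : R) : 0 < x -> 0 <= t ->
  t `^ x * expR (- t) <= (2 * x) `^ x * expR (- (t / 2)).
Proof.
move=> x0 t0.
have t_le : t <= 2 * x * expR (t / (2 * x)).
  have le1 := expR_ge1Dx (t / (2 * x)).
  have : t / (2 * x) <= expR (t / (2 * x)) by lra.
  by rewrite ler_pdivrMr ?mulr_gt0// mulrC.
have tx_le : t `^ x <= (2 * x) `^ x * expR (t / 2).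
  have : t `^ x <= (2 * x * expR (t / (2 * x))) `^ x.
    apply: ge0_ler_powR => //; rewrite ?nnegrE ?ltW//.
    by rewrite !mulr_gt0 ?expR_gt0.
  rewrite (@powRM _ (2 * x)) ?expR_ge0 ?mulr_ge0 ?(ltW x0)//.
  suff -> : expR (t / (2 * x)) `^ x = expR (t / 2) by [].
  rewrite /powR gt_eqF ?expR_gt0// expRK; congr expR; field.
  by rewrite gt_eqF.
apply: le_trans (ler_wpM2r (expR_ge0 _) tx_le) _.
rewrite -mulrA -expRD le_eqVlt; apply/orP; left; apply/eqP.
by congr (_ * expR _); field.
Qed.

(** The integrand [t ^ x * exp (- t)] has no singularity at 0 and is dominated by a multiple of the
    exponential density of rate 1/2; the factor 2 in [C] cancels that rate. *)
Lemma Gamma_e_ltoo_gt1 (R : realType) (x : R) : 0 < x ->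
  (Gamma_e (x + 1) < +oo)%E.
Proof.
move=> x0; set C : R := 2 * (2 * x) `^ x.
have C0 : 0 <= C by rewrite mulr_ge0 ?powR_ge0.
have hmp (D : set R) : measurable_fun D (EFin \o exponential_pdf (2^-1 : R)).
  by apply/measurable_EFinP/measurable_funTS; exact: measurable_exponential_pdf.
have h0 : 0 < 2^-1 :> R by rewrite invr_gt0.
apply: (@le_lt_trans _ _
  (\int[@lebesgue_measure R]_(t in `]0%R, +oo[)
     (C%:E * (exponential_pdf 2^-1 t)%:E))%E).
  apply: ge0_le_integral => //.
  - by move=> t _; rewrite lee_fin gamma_int_ge0.
  - by apply/measurable_EFinP; exact: measurable_gamma_int.
  - by apply: measurable_funeM; exact: hmp.
  - move=> t /=; rewrite in_itv/= andbT => t0.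
    rewrite -EFinM lee_fin (exponential_pdfE _ (ltW t0)) /gamma_int addrK.
    have -> : C * (2^-1 * expR (- 2^-1 * (t : R))) =
        (2 * x) `^ x * expR (- ((t : R) / 2)).
      rewrite /C.
      have -> : - 2^-1 * (t : R) = - ((t : R) / 2) by ring.
      by field.
    exact: powR_expR_bound x0 (ltW t0).
rewrite ge0_integralZl//=; [|exact: hmp|]; last first.
  by move=> t _; rewrite lee_fin exponential_pdf_ge0// ltW.
rewrite lte_mul_pinfty// ?lee_fin//.
apply: (@le_lt_trans _ _ (\int[@lebesgue_measure R]_t (exponential_pdf 2^-1 t)%:E)%E).
  apply: ge0_subset_integral => //=; first exact: hmp.
  by move=> t _; rewrite lee_fin exponential_pdf_ge0// ltW.
by rewrite integral_exponential_pdf// ltry.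
Qed.

(** The shift by two keeps [1/(n+2) < n+2] strict already at [n = 0], as integration by parts
    requires. *)
Lemma bigcup_itvcc_inv (R : realType) :
  \bigcup_n `[(n.+2%:R^-1 : R), n.+2%:R]%classic = `]0, +oo[%classic.
Proof.
apply/seteqP; split => t /=.
  move=> [n _ /=]; rewrite !in_itv/= andbT => /andP[nt _].
  by apply: lt_le_trans nt; rewrite invr_gt0 ltr0n.
rewrite in_itv/= andbT => t0.
(* One index serves both ends: [t] controls the upper one, [t^-1] the lower one. *)
exists (maxn (Num.truncn t) (Num.truncn t^-1)) => //=.
set N := maxn _ _; rewrite in_itv/=.
have le_N (y : R) : (Num.truncn y <= N)%N -> y <= N.+2%:R.
  move=> yN; apply: le_trans (ltW (truncnS_gt y)) _.
  by rewrite ler_nat ltnS (leq_trans yN).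
rewrite le_N ?leq_maxl// andbT -[leRHS]invrK lef_pV2 ?posrE ?invr_gt0//.
by rewrite le_N ?leq_maxr.
Qed.

Lemma nondecreasing_itvcc_inv (R : realType) :
  nondecreasing_seq (fun n => `[(n.+2%:R^-1 : R), n.+2%:R]%classic).
Proof.
move=> m n mn; apply/subsetPset; apply: subset_itv; rewrite bnd_simp.
  by rewrite lef_pV2 ?posrE// ler_nat.
by rewrite ler_nat.
Qed.

Lemma integral_gamma_int_parts (R : realType) (x a b : R) : 0 < x -> 0 < a -> a < b ->
  (\int[@lebesgue_measure R]_(t in `[a, b]) (gamma_int (x + 1) t)%:E =
   (gamma_int (x + 1) a - gamma_int (x + 1) b)%:E +
   \int[@lebesgue_measure R]_(t in `[a, b]) (x * gamma_int x t)%:E)%E.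
Proof.
move=> x0 a0 ab.
have pos t : t \in `[a, b] -> 0 < t.
  by rewrite in_itv/= => /andP[at_ _]; exact: lt_le_trans at_.
have dP (p t : R) : 0 < t -> {for t, continuous (@powR R ^~ p)}.
  move=> t0; apply: differentiable_continuous; apply/derivable1_diffP.
  by apply: derivable_powR; rewrite in_itv/= andbT.
have cE (t : R) : {for t, continuous (fun u : R => expR (- u))}.
  by apply: continuous_comp; [exact: opp_continuous|exact: continuous_expR].
have wc (f : R -> R) : (forall t, 0 < t -> {for t, continuous f}) ->
    {within `[a, b], continuous f}.
  move=> cf; apply: continuous_in_subspaceT => t; rewrite inE/= => /pos.
  exact: cf.
have dE (t : R) : is_derive t 1 (fun u : R => - expR (- u)) (expR (- t)).
  have := is_deriveN (@is_derive1_comp R expR -%R t _ _ (is_derive_expR (- t))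
    (is_deriveN (is_derive_id t 1))).
  by rewrite mulrN1 opprK.
have ab_itv t : t \in `]a, b[ -> 0 < t.
  by rewrite in_itv/= => /andP[+ _]; exact: lt_trans.
have b0 := lt_trans a0 ab.
under eq_integral => t _ do rewrite /gamma_int addrK.
rewrite (@integration_by_parts R (@powR R ^~ x) (fun t => - expR (- t))
  (fun t => x * t `^ (x - 1)) (fun t => expR (- t)))//.
- rewrite /gamma_int addrK; congr (_ + _)%E; first by congr EFin; ring.
  (* The remaining integrand carries the sign of the antiderivative [- expR (- t)]; nonnegativity of
     its opposite allows the sign to be pulled out. *)
  rewrite -[RHS]oppeK -[X in _ = (- X)%E]integral_ge0N/=; last first.
    by move=> t _; rewrite lee_fin !mulr_ge0 ?powR_ge0 ?expR_ge0 ?(ltW x0).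
  by congr (- _)%E; apply: eq_integral => t _; congr EFin;
    rewrite /gamma_int; ring.
- apply: wc => t t0; apply: cvgM; [exact: cvg_cst|exact: dP].
- split.
  + by move=> t /ab_itv t0; apply: derivable_powR; rewrite in_itv/= andbT.
  + exact/cvg_at_right_filter/dP.
  + exact/cvg_at_left_filter/dP.
- by move=> t /ab_itv t0; rewrite powR_derive1// in_itv/= andbT.
- by apply: wc => t _; exact: cE.
- split.
  + by move=> t _; exact: ex_derive.
  + by apply/cvg_at_right_filter; apply: cvgN; exact: cE.
  + by apply/cvg_at_left_filter; apply: cvgN; exact: cE.
- by move=> t _; rewrite derive1E derive_val.
Qed.

Lemma Gamma_e_ge0 (R : realType) (x : R) : (0 <= Gamma_e x)%E.
Proof. by apply: integral_ge0 => t _; rewrite lee_fin gamma_int_ge0. Qed.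

Lemma cvg_itvcc_inv (R : realType) : ((n.+2%:R^-1 : R) @[n --> \oo] --> 0).
Proof. by have := @cvg_harmonic R; rewrite -cvg_shiftS. Qed.

Lemma cvg_gamma_int_0 (R : realType) (x : R) : 0 < x ->
  gamma_int (x + 1) n.+2%:R^-1 @[n --> \oo] --> 0.
Proof.
move=> x0.
apply: (@squeeze_cvgr _ _ _ _ (fun=> 0) (fun n => (n.+2%:R^-1 : R) `^ x)).
- near=> n; rewrite gamma_int_ge0/= /gamma_int addrK ler_piMr ?powR_ge0//.
- exact: cvg_cst.
- have /cvg_at_rightP := powR_cvg0 x0; apply; split.
    by move=> n; rewrite invr_gt0.
  exact: cvg_itvcc_inv.
Unshelve. all: by end_near. Qed.

Lemma cvg_gamma_int_oo (R : realType) (x : R) : 0 < x ->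
  gamma_int (x + 1) n.+2%:R @[n --> \oo] --> 0.
Proof.
move=> x0.
apply: (@squeeze_cvgr _ _ _ _ (fun=> 0)
  (fun n => (2 * x) `^ x * 2 * (n.+2%:R^-1 : R))).
- near=> n; rewrite gamma_int_ge0/= /gamma_int addrK.
  have /le_trans := powR_expR_bound x0 (ler0n R n.+2); apply.
  (* What remains is [exp (- u) <= 1/u] for [u = (n+2)/2], a consequence of [1 + u <= exp u]. *)
  rewrite -mulrA ler_wpM2l ?powR_ge0// expRN -[leLHS]invrK -[leRHS]invrK.
  rewrite lef_pV2 ?posrE ?invr_gt0 ?expR_gt0 ?mulr_gt0 ?invr_gt0//.
  rewrite invrK invfM invrK mulrC.
  by apply: le_trans (expR_ge1Dx _); rewrite lerDr.
- exact: cvg_cst.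
- by rewrite -(mulr0 ((2 * x) `^ x * 2)); apply: cvgMr; exact: cvg_itvcc_inv.
Unshelve. all: by end_near. Qed.

(* By parts on the compact [1/(n+2), n+2], which avoids the singularity of
   t^(x-1) at 0, then n -> oo by monotone convergence. *)
Lemma Gamma_eS (R : realType) (x : R) : 0 < x ->
  (Gamma_e (x + 1) = x%:E * Gamma_e x)%E.
Proof.
move=> x0.
pose F n : set R := `[n.+2%:R^-1, n.+2%:R]%classic.
(* The factor [c] lets one limit serve both integrals: [c = 1] at [x + 1] and [c = x] at [x]. *)
have cvgF y (c : R) : 0 <= c ->
    (\int[@lebesgue_measure R]_(t in F n) (c * gamma_int y t)%:E @[n --> \oo] -->
     \int[@lebesgue_measure R]_(t in `]0%R, +oo[) (c * gamma_int y t)%:E)%E.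
  move=> c0; rewrite -bigcup_itvcc_inv.
  apply: ge0_nondecreasing_set_cvg_integral => //.
  - exact: nondecreasing_itvcc_inv.
  - by move=> n; exact: measurable_itv.
  - move=> n; apply/measurable_EFinP; apply: measurable_funM => //.
    exact: measurable_gamma_int.
  - by move=> n t _; rewrite lee_fin mulr_ge0 ?gamma_int_ge0.
have -> : (x%:E * Gamma_e x =
    \int[@lebesgue_measure R]_(t in `]0%R, +oo[) (x * gamma_int x t)%:E)%E.
  under [RHS]eq_integral do rewrite EFinM.
  rewrite ge0_integralZl//=; last exact: ltW.
  - by apply/measurable_EFinP; exact: measurable_gamma_int.
  - by move=> t _; rewrite lee_fin gamma_int_ge0.
have h1 := cvgF (x + 1) 1 ler01.
have h2 := cvgF x x (ltW x0).
have parts n : (\int[@lebesgue_measure R]_(t in F n) (1 * gamma_int (x + 1) t)%:E =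
    (gamma_int (x + 1) n.+2%:R^-1 - gamma_int (x + 1) n.+2%:R)%:E +
    \int[@lebesgue_measure R]_(t in F n) (x * gamma_int x t)%:E)%E.
  under eq_integral do rewrite mul1r.
  apply: integral_gamma_int_parts; rewrite ?invr_gt0//.
  by apply: (@lt_trans _ _ 1); rewrite ?invf_lt1// ltr1n.
have h3 : (\int[@lebesgue_measure R]_(t in F n) (1 * gamma_int (x + 1) t)%:E
    @[n --> \oo] -->
    (0 - 0)%:E + \int[@lebesgue_measure R]_(t in `]0%R, +oo[) (x * gamma_int x t)%:E)%E.
  under eq_cvg do rewrite parts.
  apply: cvgeD => //.
    apply: cvg_EFin; first exact: nearW.
    by apply: cvgB; [exact: cvg_gamma_int_0|exact: cvg_gamma_int_oo].
have := cvg_unique _ h1 h3; rewrite subr0 add0e => <- //.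
by under [RHS]eq_integral do rewrite mul1r.
Qed.

(** An infinite value at [x] would, by the functional equation, make the value at [x + 1]
    infinite. *)
Lemma Gamma_e_ltoo (R : realType) (x : R) : 0 < x -> (Gamma_e x < +oo)%E.
Proof.
move=> x0; have := Gamma_e_ltoo_gt1 x0; rewrite (Gamma_eS x0).
case: (Gamma_e x) => [r _|+|//]; first exact: ltry.
by rewrite gt0_muley ?lte_fin.
Qed.

Lemma Gamma_e_gt0 (R : realType) (x : R) : 0 < x -> (0 < Gamma_e x)%E.
Proof.
move=> x0.
suff : (0 < Gamma_e (x + 1))%E.
  by rewrite (Gamma_eS x0) pmule_rgt0.
(* After the shift the exponent is [x > 0], so on [[1, 2]] the integrand is at least
   [1 * exp (- 2)]. *)
apply: (@lt_le_trans _ _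
  (\int[@lebesgue_measure R]_(t in `[1%R, 2%R]) (expR (- 2))%:E)%E).
  rewrite integral_cst//= lebesgue_measure_itv/= lte_fin ltr1n/= -EFinB.
  by rewrite -EFinM lte_fin mulr_gt0 ?expR_gt0//; lra.
apply: (@le_trans _ _
  (\int[@lebesgue_measure R]_(t in `[1%R, 2%R]) (gamma_int (x + 1) t)%:E)%E).
  apply: ge0_le_integral => //.
  - by apply/measurable_EFinP; exact: measurable_gamma_int.
  - move=> t /=; rewrite in_itv/= => /andP[t1 t2].
    rewrite lee_fin /gamma_int addrK -[leLHS]mul1r ler_pM ?expR_ge0//.
      by rewrite -(powRr0 (t : R)) ler_powR// ltW.
    by rewrite ler_expR lerN2.
apply: ge0_subset_integral => //=.
- by apply/measurable_EFinP; exact: measurable_gamma_int.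
- by move=> t _; rewrite lee_fin gamma_int_ge0.
- by move=> t /=; rewrite !in_itv/= andbT => /andP[+ _]; exact: lt_le_trans.
Qed.

Lemma Gamma_gt0 (R : realType) (x : R) : 0 < x -> 0 < Gamma x.
Proof.
move=> x0; apply: fine_gt0; apply/andP; split.
  exact: Gamma_e_gt0.
exact: Gamma_e_ltoo.
Qed.

Lemma GammaS (R : realType) (x : R) : 0 < x -> Gamma (x + 1) = x * Gamma x.
Proof.
move=> x0; rewrite -[RHS]/(fine x%:E * fine (Gamma_e x)) -fineM//.
  by rewrite -Gamma_eS.
by rewrite ge0_fin_numE ?Gamma_e_ltoo ?Gamma_e_ge0.
Qed.

(** * Superadditivity of convex sequences *)

Lemma convex_seq_superadditive (R : realDomainType) (w : nat -> R) :
  w 0%N = 0 -> w 1%N = 0 ->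
  (forall m, w m.+1 - w m <= w m.+2 - w m.+1) ->
  forall p q, w 2%N <= w (p.+1 + q.+1)%N - w p.+1 - w q.+1.
Proof.
move=> w0 w1 wconv.
have incr m j : w m.+1 - w m <= w (m + j).+1 - w (m + j)%N.
  elim: j => [|j IH]; first by rewrite addn0.
  by rewrite addnS; exact: le_trans IH (wconv _).
move=> p; elim=> [|q IH].
  by have := incr 1%N p; rewrite w1 !subr0 addn1 add1n.
(* Raising [q] by one changes the gap by the increment of [w] at [p + q + 2] minus the one at
   [q + 1], which is nonnegative. *)
have := incr q.+1 p.+1; rewrite addnC -addnS => h.
apply: le_trans IH _; lra.
Qed.

(** * The bracket of [L_] for an abstract ratio sequence *)

Section ratio_sequence.
Variables (R : realFieldType) (a : R) (g : nat -> R).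
Hypotheses (a_gt0 : 0 < a) (a_lt1 : a < 1).
Hypothesis g_gt0 : forall m, 0 < g m.
Hypothesis gS : forall m, g m.+1 = g m * ((a + m%:R) / (1 - a + m%:R)).

Definition ell (m : nat) : R :=
  \sum_(0 <= k < m) g k * (1 / (1 - a + k%:R)) - g m - g 0%N.

Definition ell_step (m : nat) : R := g m / (1 - a + m%:R).

Let den_gt0 (m : nat) : 0 < 1 - a + m%:R.
Proof. by rewrite ltr_wpDr ?ler0n// subr_gt0. Qed.

Let den_neq0 (m : nat) : 1 - a + m%:R != 0.
Proof. by rewrite gt_eqF. Qed.

Let ell_step_gt0 m : 0 < ell_step m.
Proof. by rewrite divr_gt0. Qed.

(** The new summand is [ell_step m], and [gS] gives [g m - g m.+1 = (1 - 2 * a) * ell_step m]. *)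
Let ellS m : ell m.+1 = ell m + 2 * (1 - a) * ell_step m.
Proof. by rewrite /ell /ell_step big_nat_recr//= gS; field. Qed.

Lemma ell1 : ell 1 = 0.
Proof. by rewrite /ell big_nat1 gS; have := den_neq0 0; rewrite addr0 => ?; field. Qed.

Lemma ell2_gt0 : 0 < ell 2.
Proof. by rewrite ellS ell1 add0r mulr_gt0// mulr_gt0// subr_gt0. Qed.

Let ell_stepS m : (2 - a + m%:R) * ell_step m.+1 = (a + m%:R) * ell_step m.
Proof.
have := den_neq0 m.+1; rewrite /ell_step gS -natr1 => d.
field; rewrite den_neq0/=.
by apply: contraNN d => /eqP d; apply/eqP; lra.
Qed.

Let mul_ell_convex m :
  m.+1%:R * ell m.+1 - m%:R * ell m <= m.+2%:R * ell m.+2 - m.+1%:R * ell m.+1.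
Proof.
have am_gt0 : 0 < a + m%:R by rewrite ltr_wpDr.
have key : 0 <= m.+2%:R * ell_step m.+1 - m%:R * ell_step m.
  (* Multiplying by [a + m] lets [ell_stepS] express both terms through [ell_step m.+1]; the
     coefficient is [(a+m)(m+2) - m(2-a+m) = 2a(m+1)]. *)
  rewrite -(pmulr_rge0 _ am_gt0).
  have -> : (a + m%:R) * (m.+2%:R * ell_step m.+1 - m%:R * ell_step m) =
      2 * a * (m%:R + 1) * ell_step m.+1.
    by rewrite mulrBr [X in _ - X]mulrCA -ell_stepS -addn2 natrD; ring.
  by rewrite mulr_ge0 ?(ltW (ell_step_gt0 _))// mulr_ge0 ?addr_ge0// mulr_ge0// ltW.
rewrite -subr_ge0.
(* Expanding around [ell m.+1], its coefficients [m+2], [-2(m+1)] and [m] cancel. *)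
have -> : m.+2%:R * ell m.+2 - m.+1%:R * ell m.+1 -
    (m.+1%:R * ell m.+1 - m%:R * ell m) =
    2 * (1 - a) * (m.+2%:R * ell_step m.+1 - m%:R * ell_step m).
  by rewrite !ellS -(natr1 m.+1) -(natr1 m); ring.
by rewrite mulr_ge0// mulr_ge0// subr_ge0 ltW.
Qed.

Lemma mul_ell_superadditive p q : 2 * ell 2 <=
  (p.+1 + q.+1)%:R * ell (p.+1 + q.+1) - p.+1%:R * ell p.+1 - q.+1%:R * ell q.+1.
Proof.
apply: (@convex_seq_superadditive _ (fun m => m%:R * ell m)).
- exact: mul0r.
- by rewrite ell1 mulr0.
- exact: mul_ell_convex.
Qed.

End ratio_sequence.

(** * Specialization to Gamma ratios and [omega] *)

Definition Gamma_ratio {R : realType} (a : R) (m : nat) : R :=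
  Gamma (a + m%:R) / Gamma (1 - a + m%:R).

Lemma Gamma_ratio_gt0 (R : realType) (a : R) m : 0 < a < 1 -> 0 < Gamma_ratio a m.
Proof.
by case/andP=> a_gt0 a_lt1; rewrite divr_gt0// Gamma_gt0// ltr_wpDr// subr_gt0.
Qed.

Lemma Gamma_ratioS (R : realType) (a : R) m : 0 < a < 1 ->
  Gamma_ratio a m.+1 = Gamma_ratio a m * ((a + m%:R) / (1 - a + m%:R)).
Proof.
case/andP=> a_gt0 a_lt1.
have n_gt0 : 0 < a + m%:R by rewrite ltr_wpDr.
have d_gt0 : 0 < 1 - a + m%:R by rewrite ltr_wpDr// subr_gt0.
rewrite /Gamma_ratio -natr1 !addrA (GammaS n_gt0) (GammaS d_gt0).
by rewrite invfM mulrACA mulrC.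
Qed.

Definition omega_cst {R : realType} (alpha : R) : R :=
  c_ alpha / (2 * (1 - alpha / 2)) *
  (Gamma (2 - alpha) / (Gamma (1 - alpha / 2) * Gamma (alpha / 2))).

Section omega.
Variables (R : realType) (alpha : R) (halpha : 0 < alpha < 2).

Let half_itv : 0 < alpha / 2 < 1.
Proof. by case/andP: halpha => *; apply/andP; split; lra. Qed.

Let half_gt0 : 0 < alpha / 2. Proof. by case/andP: half_itv. Qed.

Let half_lt1 : alpha / 2 < 1. Proof. by case/andP: half_itv. Qed.

Lemma omega_cst_gt0 : 0 < omega_cst alpha.
Proof.
have Ga : 0 < Gamma (alpha / 2) by exact: Gamma_gt0.
have Gb : 0 < Gamma (1 - alpha / 2) by rewrite Gamma_gt0// subr_gt0.
have Gc : 0 < Gamma (2 - alpha) by rewrite Gamma_gt0// subr_gt0; case/andP: halpha.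
have P : 0 < 2 `^ (1 - alpha) :> R by exact: powR_gt0.
have h : 0 < 1 - alpha / 2 by rewrite subr_gt0.
rewrite /omega_cst /c_.
move: (Gamma (alpha / 2)) (Gamma (1 - alpha / 2)) (Gamma (2 - alpha))
  Ga Gb Gc => u v w u0 v0 w0.
by rewrite !(mulr_gt0, invr_gt0).
Qed.

(** Once the common prefactor of [T1] and [T2] is pulled out, the constant term of the bracket
    becomes [Gamma (alpha / 2) / Gamma (1 - alpha / 2)], which is [Gamma_ratio] at 0. *)
Lemma L_E m : L_ alpha m = omega_cst alpha * ell (alpha / 2) (Gamma_ratio (alpha / 2)) m.
Proof.
have Ga : Gamma (alpha / 2) != 0 by rewrite gt_eqF ?Gamma_gt0.
have Gb : Gamma (1 - alpha / 2) != 0 by rewrite gt_eqF ?Gamma_gt0 ?subr_gt0.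
rewrite /ell /Gamma_ratio !addr0.
have alg (c s g u v w : R) : u != 0 -> v != 0 ->
    c * (w / (v * u) * s - w / (v * u) * g - w / v ^+ 2) =
    c * (w / (v * u)) * (s - g - u / v).
  by move=> u0 v0; field; rewrite u0 v0.
exact: alg.
Qed.

Lemma omega_superadditive (p q : nat) :
  omega alpha 2 <= omega alpha (p.+1 + q.+1)%N - omega alpha p.+1 - omega alpha q.+1.
Proof.
have omegaE (m : nat) : omega alpha m =
    omega_cst alpha * (m%:R * ell (alpha / 2) (Gamma_ratio (alpha / 2)) m).
  by rewrite /omega absz_nat L_E mulrCA.
rewrite !omegaE -!mulrBr ler_pM2l ?omega_cst_gt0//.
apply: mul_ell_superadditive => // m.
- exact: Gamma_ratio_gt0.
- exact: Gamma_ratioS.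
Qed.

Lemma omega2_gt0 : 0 < omega alpha 2.
Proof.
rewrite /omega L_E mulr_gt0// mulr_gt0 ?omega_cst_gt0//.
apply: ell2_gt0 => // m.
- exact: Gamma_ratio_gt0.
- exact: Gamma_ratioS.
Qed.

End omega.

(** * Reduction of signs by oddness, and conclusion *)

Lemma odd_superadditive_gap (R : realFieldType) (w : int -> R) (c : R) :
  (forall j, w (- j) = - w j) ->
  (forall p q, 0 < p -> 0 < q -> c <= w (p + q) - w p - w q) ->
  forall n j k, n != 0 -> j != 0 -> k != 0 -> k = j + n ->
  c <= `|w k - w j - w n|.
Proof.
move=> wN super n j k.
(* Negating all three indices preserves [k = j + n] and only flips the sign inside the norm. *)
wlog k_gt0 : n j k / 0 < k.
  move=> H hn hj hk hkjn.
  case: (ltrgtP k 0) (hk) => // [k_lt0 _|k_gt0 _]; last exact: H.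
  have -> : w k - w j - w n = - (w (- k) - w (- j) - w (- n)).
    by rewrite !wN; ring.
  by rewrite normrN; apply: H; rewrite ?oppr_eq0 ?oppr_gt0// hkjn opprD.
move=> hn hj _ hkjn; case: (ltrgtP j 0) hj => // [j_lt0|j_gt0] _;
  case: (ltrgtP n 0) hn => // [n_lt0|n_gt0] _.
- by have := ltrD j_lt0 n_lt0; rewrite -hkjn addr0 ltNge ltW.
(* For [j < 0 < n], read the relation as [n = k + (- j)] with positive summands: by oddness its gap
   is the opposite of the original one. The case [n < 0 < j] is symmetric. *)
- rewrite -normrN; apply: le_trans (ler_norm _).
  have := super k (- j) k_gt0; rewrite oppr_gt0 => /(_ j_lt0).
  have -> : k - j = n by rewrite hkjn; ring.
  by rewrite wN; lra.
- rewrite -normrN; apply: le_trans (ler_norm _).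
  have := super k (- n) k_gt0; rewrite oppr_gt0 => /(_ n_lt0).
  have -> : k - n = j by rewrite hkjn; ring.
  by rewrite wN; lra.
- apply: le_trans (ler_norm _); rewrite hkjn.
  exact: super.
Qed.

Lemma omegaN (R : realType) (alpha : R) (j : int) :
  omega alpha (- j) = - omega alpha j.
Proof. by rewrite /omega abszN mulrNz mulNr. Qed.

Theorem lemma3p5 (R : realType) (alpha : R) (halpha : 0 < alpha < 2)
    (n j k : int) (hn : n != 0) (hj : j != 0) (hk : k != 0)
    (hkjn : k = j + n) :
  omega alpha 2 <= `|omega alpha k - omega alpha j - omega alpha n| /\
  0 < omega alpha 2.
Proof.
split; last exact: omega2_gt0.
apply: odd_superadditive_gap hkjn => //; first exact: omegaN.
case=> [[|p]|p]// [[|q]|q]// _ _.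
exact: omega_superadditive.
Qed.
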